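(* Let $R$ be a ring with identity, $J(R)$ its Jacobson radical, $a,b,c\in R$ and $j_a,j_b,j_c\in J(R)$. Suppose the $(b,c)$-inverse $a^{\|(b,c)}$ exists (so that $b$ and $c$ are regular), and let $b^+$ and $c^+$ be reflexive inverses of $b$ and $c$, respectively. Then the following statements are equivalent: (1) $(a+j_a)^{\|(b+j_b,c+j_c)}$ exists; (2) $b+j_b$ and $c+j_c$ are regular; (3) $(1-bb^+)j_b(1+b^+j_b)^{-1}(1-b^+b)=0$ and $(1-cc^+)j_c(1+c^+j_c)^{-1}(1-c^+c)=0$. In this case, $$(a+j_a)^{\|(b+j_b,c+j_c)}=(1+j_bb^+)\,a^{\|(b,c)}\,(1+ja^{\|(b,c)})^{-1}(1+c^+j_c),$$ where $$j=j_a+aj_bb^++c^+j_ca+j_aj_bb^++c^+j_cj_a+c^+j_caj_bb^++c^+j_cj_aj_bb^+.$$ Moreover, in this case $a^{\|(b+j_b,c+j_c)}$ exists, $$a^{\|(b+j_b,c+j_c)}=(1+j_bb^+)\bigl(1+a^{\|(b,c)}(aj_bb^++c^+j_ca+c^+j_caj_bb^+)\bigr)^{-1}a^{\|(b,c)}(1+c^+j_c),$$ and $$(a+j_a)^{\|(b+j_b,c+j_c)}=(1+a^{\|(b+j_b,c+j_c)}j_a)^{-1}a^{\|(b+j_b,c+j_c)}.$$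
   Context: Rings are associative with identity, not necessarily commutative. For $a,b,c\in R$, an element $y\in R$ is the $(b,c)$-inverse of $a$ if $cay=c$, $yab=b$ and $y\in bR\cap Rc$; such $y$ is unique if it exists and is denoted $a^{\|(b,c)}$. It is known that if $a^{\|(b,c)}$ exists then $b$ and $c$ are regular. An element $r\in R$ is regular if $rxr=r$ for some $x\in R$; a reflexive inverse of $r$ is an element $x$ with $rxr=r$ and $xrx=x$ (every regular element has one). *)

(* Defs.v *)
From mathcomp Require Import all_boot all_order all_algebra.
From mathcomp Require Import boolp classical_sets.

Set Implicit Arguments.
Unset Strict Implicit.
Unset Printing Implicit Defensive.

Import GRing.Theory.
Local Open Scope classical_set_scope.
Local Open Scope ring_scope.

Definition is_left_ideal (R : pzRingType) (I : set R) : Prop :=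
  [/\ I 0, forall x y : R, I x -> I y -> I (x - y)
    & forall r x : R, I x -> I (r * x)].

Definition is_maximal_left_ideal (R : pzRingType) (M : set R) : Prop :=
  [/\ is_left_ideal M, M != setT
    & forall I : set R, is_left_ideal I -> M `<=` I -> I = M \/ I = setT].

(* In the zero ring there is no maximal left ideal and the radical is the whole
   ring, as usual. *)
Definition jacobson_radical (R : pzRingType) : set R :=
  \bigcap_(M in @is_maximal_left_ideal R) M.

Definition is_inverse (R : pzRingType) (x y : R) : Prop :=
  x * y = 1 /\ y * x = 1.

Definition invertible (R : pzRingType) (x : R) : Prop :=
  exists y : R, is_inverse x y.

(* [GRing.inv] is only available on a [unitRingType], which excludes the zero
   ring and carries a chosen unit predicate, hence the inverse by choice below.
   The value is meaningful only when [invertible x] (otherwise it is 0). *)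
Definition rinv (R : pzRingType) (x : R) : R := xget 0 [set y | is_inverse x y].

Definition is_regular (R : pzRingType) (r : R) : Prop :=
  exists x : R, r * x * r = r.

Definition is_reflexive_inverse (R : pzRingType) (r x : R) : Prop :=
  r * x * r = r /\ x * r * x = x.

Definition is_bc_inverse (R : pzRingType) (a b c y : R) : Prop :=
  [/\ c * a * y = c, y * a * b = b,
      exists r : R, y = b * r & exists s : R, y = s * c].

Definition bc_invertible (R : pzRingType) (a b c : R) : Prop :=
  exists y : R, is_bc_inverse a b c y.

(* Meaningful only when [bc_invertible a b c] (otherwise it is 0), in which case
   the (b,c)-inverse is unique. *)
Definition bc_inv (R : pzRingType) (a b c : R) : R :=
  xget 0 [set y | is_bc_inverse a b c y].

(* Main.v *)
(** The (b,c)-inverse of [a] depends on [b] and [c] only through [bR] and [Rc].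
    Put [v := 1 + jb * b^+] and [u := 1 + c^+ * jc], which are units.  If
    [b + jb] and [c + jc] are regular, then [(b + jb)R = v b R] and
    [R(c + jc) = R c u], so the (b + jb, c + jc)-inverse of [x] is [v * y' * u]
    with [y'] the (b,c)-inverse of [u * x * v].  For [x = a + ja] one has
    [u * x * v = a + j] with [j] in the radical, and the (b,c)-inverse of
    [a + j] is [y * (1 + j * y)^-1 = (1 + y * j)^-1 * y]. *)

Require Import Defs.
From mathcomp Require Import all_boot all_order all_algebra.
From mathcomp Require Import boolp classical_sets.

Set Implicit Arguments.
Unset Strict Implicit.
Unset Printing Implicit Defensive.

Import GRing.Theory.
Local Open Scope ring_scope.

(** * Left ideals and the existence of maximal ones *)

Section LeftIdeals.
Local Open Scope classical_set_scope.
Variable R : pzRingType.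
Implicit Types (x y r : R) (I M : set R).

Lemma left_idealD I x y : is_left_ideal I -> I x -> I y -> I (x + y).
Proof.
move=> [I0 IB _] Ix Iy; rewrite -[y]opprK; apply: (IB) => //.
by rewrite -sub0r; apply: IB.
Qed.

Lemma left_ideal_setT I : is_left_ideal I -> I 1 -> I = setT.
Proof.
by move=> [_ _ IM] I1; apply/seteqP; split=> // x _; rewrite -[x]mulr1; apply: IM.
Qed.

Lemma maximal_left_ideal_proper M : is_maximal_left_ideal M -> ~ M 1.
Proof. by move=> [Mid /eqP MT _] M1; apply: MT; apply: left_ideal_setT. Qed.

Lemma left_ideal_add_cyclic M x :
  is_left_ideal M -> is_left_ideal [set w | exists r, exists2 m, M m & w = r * x + m].
Proof.
move=> [M0 MB MM]; split.
- by exists 0, 0; rewrite // mul0r addr0.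
- move=> _ _ [r [m Mm ->]] [s [n Mn ->]]; exists (r - s), (m - n); first exact: MB.
  by rewrite mulrBl addrACA opprD.
- move=> s _ [r [m Mm ->]]; exists (s * r), (s * m); first exact: MM.
  by rewrite mulrDr mulrA.
Qed.

(** [R * x + M] is a left ideal strictly larger than [M], hence everything by maximality. *)
Lemma maximal_left_ideal_addP M x : is_maximal_left_ideal M -> ~ M x ->
  forall w, exists r, exists2 m, M m & w = r * x + m.
Proof.
move=> [Mid _ Mmax] Mx w; have [M0 _ _] := Mid.
have [m Mm||E] := Mmax _ (left_ideal_add_cyclic x Mid).
- by exists 0, m; rewrite // mul0r add0r.
- by move=> E; case: Mx; rewrite -E; exists 1, 0; rewrite // mul1r addr0.
- by have : [set: R] w by []; rewrite -E.
Qed.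

(* The maximal element provided by [Zorn_bigcup] ranges over a family that must
   contain the union of the empty chain, hence the empty set. *)
Lemma maximal_left_ideal_exists x : (forall r, r * x <> 1) ->
  exists2 M, is_maximal_left_ideal M & M x.
Proof.
move=> xN1.
pose P I := [/\ forall u v, I u -> I v -> I (u - v),
  forall r u, I u -> I (r * u), ~ I 1 & forall u, I u -> I x].
have [F FP Ftot|A [[AB AM A1 Ax] Amax]] := @Zorn_bigcup R P.
  split.
  - move=> u v [X FX Xu] [Y FY Yv].
    have [XY|YX] := Ftot _ _ FX FY.
      by exists Y => //; have [YB _ _ _] := FP _ FY; apply: YB => //; apply: XY.
    by exists X => //; have [XB _ _ _] := FP _ FX; apply: XB => //; apply: YX.
  - by move=> r u [X FX Xu]; exists X => //; have [_ XM _ _] := FP _ FX; apply: XM.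
  - by move=> [X FX X1]; have [] := FP _ FX.
  - move=> u [X FX Xu]; exists X => //; have [_ _ _ Xx] := FP _ FX.
    exact: Xx Xu.
(* If [x] were missing, the last clause of [P] would make [A] empty, and the strictly larger [R * x]
   would contradict maximality. *)
have Axx : A x.
  apply: contrapT => NAx.
  apply: (Amax [set w | exists r, w = r * x]).
    split; first by move=> u /Ax.
    by move/(_ x) => h; apply: NAx; apply: h; exists 1; rewrite mul1r.
  split.
  - by move=> _ _ [r ->] [s ->]; exists (r - s); rewrite mulrBl.
  - by move=> s _ [r ->]; exists (s * r); rewrite mulrA.
  - by move=> [r /esym]; apply: xN1.
  - by move=> _ _; exists 1; rewrite mul1r.
have A0 : A 0 by rewrite -[0](mul0r x); apply: AM.
exists A => //; split=> //.
  by apply/eqP => AT; apply: A1; rewrite AT.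
move=> I Iid AI; have [_ IB IM] := Iid.
have [I1|NI1] := pselect (I 1); first by right; apply: left_ideal_setT.
left; apply/seteqP; split=> //; apply: contrapT => NIA.
by apply: (Amax I) => //; split=> // _ _; apply: AI.
Qed.

End LeftIdeals.

(** * The Jacobson radical as a two-sided ideal, and the units [1 + x] *)

Section JacobsonRadical.
Local Open Scope classical_set_scope.
Variable R : pzRingType.
Implicit Types x y r : R.

Lemma jacobson_radicalD x y :
  jacobson_radical x -> jacobson_radical y -> jacobson_radical (x + y).
Proof.
move=> Jx Jy M Mmax; have [Mid _ _] := Mmax.
by apply: left_idealD => //; [apply: Jx | apply: Jy].
Qed.

Lemma jacobson_radicalMl r x : jacobson_radical x -> jacobson_radical (r * x).
Proof. by move=> Jx M Mmax; have [[_ _ MM] _ _] := Mmax; apply: MM; apply: Jx. Qed.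

Lemma jacobson_radicalN x : jacobson_radical x -> jacobson_radical (- x).
Proof. by rewrite -mulN1r; apply: jacobson_radicalMl. Qed.

(* For [M] maximal, the quotient [{w | w * r \in M}] is maximal or everything. *)
Lemma jacobson_radicalMr x r : jacobson_radical x -> jacobson_radical (x * r).
Proof.
move=> Jx M Mmax; have [Mid _ _] := Mmax; have [M0 MB MM] := Mid.
have [Mr|NMr] := pselect (M r); first exact: MM.
apply: (Jx [set w | M (w * r)]); split; first split.
- by rewrite /= mul0r.
- by move=> u v /= Mu Mv; rewrite mulrBl; apply: MB.
- by move=> s u /= Mu; rewrite -mulrA; apply: MM.
- by apply/eqP => E; apply: NMr; rewrite -[r]mul1r; have : [set: R] 1 by []; rewrite -E.
move=> I Iid QI; have [IQ|] := pselect (I `<=` [set w | M (w * r)]).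
  by left; apply/seteqP.
move=> /existsNP[w /not_implyP[Iw NMw]]; right; apply: left_ideal_setT => //.
(* As [w * r] is outside [M], [r = s * (w * r) + m]; hence [1 - s * w] lies in the quotient, and [I]
   contains both it and [s * w]. *)
have [s [m Mm E]] := maximal_left_ideal_addP Mmax NMw r.
have [_ _ IM] := Iid.
rewrite -[1](subrK (s * w)); apply: left_idealD; [by []| |exact: IM].
by apply: QI; rewrite /= mulrBl mul1r {1}E -mulrA addrC addKr.
Qed.

(** Otherwise some maximal left ideal would contain [1 + x] along with [x], hence [1]. *)
Lemma jacobson_radical_linv x : jacobson_radical x -> exists r, r * (1 + x) = 1.
Proof.
move=> Jx; apply: contrapT => /forallNP /maximal_left_ideal_exists[M Mmax Mx].
have [[_ MB _] _ _] := Mmax; apply: (maximal_left_ideal_proper Mmax).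
by rewrite -[1](addrK x); apply: MB => //; apply: Jx.
Qed.

(** A left inverse [r] equals [1 - r * x], again 1 plus a radical element, so [r] has a left inverse
    too, which must be [1 + x]. *)
Lemma invertible_jacobson x : jacobson_radical x -> invertible (1 + x).
Proof.
move=> Jx; have [r rx] := jacobson_radical_linv Jx.
have rE : r = 1 + - (r * x) by rewrite -rx mulrDr mulr1 addrK.
have /jacobson_radical_linv : jacobson_radical (- (r * x)).
  by apply: jacobson_radicalN; apply: jacobson_radicalMl.
rewrite -rE => -[s sr]; exists r; split=> //.
suff -> : 1 + x = s by [].
by rewrite -[1 + x]mul1r -{1}sr -mulrA rx mulr1.
Qed.

End JacobsonRadical.

(** * Uniqueness, change of data and perturbation of (b,c)-inverses *)

Section Inverses.
Variable R : pzRingType.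
Implicit Types x y a b c v u : R.

Lemma rinvP x : invertible x -> is_inverse x (rinv x).
Proof. by move=> [y xy]; apply: (@xgetI _ 0 [set z | is_inverse x z]%classic y). Qed.

(** Follows from [(1 + y * x) * y = y * (1 + x * y)]. *)
Lemma rinv_swap x y : invertible (1 + y * x) -> invertible (1 + x * y) ->
  rinv (1 + y * x) * y = y * rinv (1 + x * y).
Proof.
move=> /rinvP[_ Eyx] /rinvP[Exy _].
rewrite -[LHS]mulr1 -[X in _ * y * X = _]Exy [_ * (_ * rinv _)]mulrA.
have -> : rinv (1 + y * x) * y * (1 + x * y) = rinv (1 + y * x) * (1 + y * x) * y.
  by rewrite -!mulrA mulrDr mulrDl mulr1 mul1r mulrA.
by rewrite Eyx mul1r.
Qed.

(** Both equal [y * a * x]: [y * a] fixes [b], hence [x], and [c * a * x = c] carries over to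
    [y]. *)
Lemma bc_inverse_unique a b c x y :
  is_bc_inverse a b c x -> is_bc_inverse a b c y -> x = y.
Proof.
move=> [cax _ [r xr] _] [_ yab _ [s ys]].
have -> : x = y * a * x by rewrite [X in _ * X]xr mulrA yab -xr.
by rewrite {1}ys -mulrA -mulrA [c * _]mulrA cax -ys.
Qed.

Lemma bc_invP a b c : bc_invertible a b c -> is_bc_inverse a b c (bc_inv a b c).
Proof.
by move=> [y hy]; apply: (@xgetI _ 0 [set z | is_bc_inverse a b c z]%classic y).
Qed.

Lemma bc_inv_eq a b c y : is_bc_inverse a b c y -> bc_inv a b c = y.
Proof. by move=> hy; apply: (bc_inverse_unique _ hy); apply: bc_invP; exists y. Qed.

(** Writing [y = b * r] turns [y * a * b = b] into [b * (r * a) * b = b]; dually for [c]. *)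
Lemma bc_invertible_regular a b c :
  bc_invertible a b c -> is_regular b /\ is_regular c.
Proof.
move=> [y [cay yab [r yr] [s ys]]]; split.
- by exists (r * a); rewrite mulrA -yr yab.
- by exists (a * s); rewrite -!mulrA -ys mulrA cay.
Qed.

(** The four divisibilities say that [b], [b'] generate the same right ideal and [c], [c'] the same
    left ideal. *)
Lemma bc_inverse_assoc a b c b' c' y :
  (exists r, b' = b * r) -> (exists r, b = b' * r) ->
  (exists s, c' = s * c) -> (exists s, c = s * c') ->
  is_bc_inverse a b c y -> is_bc_inverse a b' c' y.
Proof.
move=> [r b'r] [r' br'] [s c's] [s' cs'] [cay yab [t yt] [w yw]]; split.
- by rewrite c's -!mulrA [c * _]mulrA cay.
- by rewrite b'r mulrA yab.
- by exists (r' * t); rewrite mulrA -br'.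
- by exists (w * s'); rewrite -mulrA -cs'.
Qed.

Lemma bc_inverse_mul a b c v u y :
  is_bc_inverse (u * a * v) b c y -> is_bc_inverse a (v * b) (c * u) (v * y * u).
Proof.
move=> [cay yab [t yt] [w yw]]; split.
- by rewrite !mulrA in cay *; rewrite cay.
- by rewrite -!mulrA in yab *; rewrite yab.
- by exists (t * u); rewrite yt !mulrA.
- by exists (v * w); rewrite yw !mulrA.
Qed.

(** The identities [c * (a + j) * y = c * (1 + j * y)] and [y * (a + j) * b = (1 + y * j) * b]
    reduce both equations to cancelling a unit, on the right or, after [rinv_swap], on the left. *)
Lemma bc_inverse_perturb a b c j y : is_bc_inverse a b c y ->
  invertible (1 + j * y) -> invertible (1 + y * j) ->
  is_bc_inverse (a + j) b c (y * rinv (1 + j * y)).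
Proof.
move=> [cay yab [t yt] [w yw]] ijy iyj.
have [Ejy _] := rinvP ijy; have [_ Eyj] := rinvP iyj; split.
- have -> : c * (a + j) * (y * rinv (1 + j * y)) = c * (1 + j * y) * rinv (1 + j * y).
    by rewrite mulrA mulrDr mulrDl cay -[c * j * y]mulrA -{1}[c]mulr1 -mulrDr.
  by rewrite -mulrA Ejy mulr1.
- rewrite -rinv_swap // -!mulrA [y * (_ * b)]mulrA mulrDr mulrDl yab.
  by rewrite -{1}[b]mul1r -mulrDl mulrA Eyj mul1r.
- by exists (t * rinv (1 + j * y)); rewrite mulrA -yt.
- by exists (rinv (1 + y * j) * w); rewrite -rinv_swap // -mulrA -yw.
Qed.

End Inverses.

(** * Regularity of [b + j] for [j] in the radical *)

Section RegularPerturbation.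
Variables (R : pzRingType) (b bp j : R).
Hypotheses (hb : is_reflexive_inverse b bp) (hj : jacobson_radical j).

Let inv_bpj : invertible (1 + bp * j).
Proof. by apply: invertible_jacobson; apply: jacobson_radicalMl. Qed.

Let inv_jbp : invertible (1 + j * bp).
Proof. by apply: invertible_jacobson; apply: jacobson_radicalMr. Qed.

(** Split [b + j = b * (1 + bp * j) + (1 - b * bp) * j]; the first summand contributes
    [b * (1 - bp * b) = 0]. *)
Let defect_eq : (b + j) * rinv (1 + bp * j) * (1 - bp * b) =
  (1 - b * bp) * j * rinv (1 + bp * j) * (1 - bp * b).
Proof.
have [Eu _] := rinvP inv_bpj.
have -> : b + j = b * (1 + bp * j) + (1 - b * bp) * j.
  by rewrite mulrDr mulrBl mulr1 mul1r mulrA addrACA subrr addr0 addrC.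
by rewrite mulrDl -[b * _ * _]mulrA Eu mulr1 mulrDl mulrBr mulr1 mulrA hb.1 subrr
  add0r.
Qed.

(** Since [bp * (b + j) = (1 + bp * j) - (1 - bp * b)], the product differs from [b + j] exactly by
    the defect. *)
Let defect0_inner : (1 - b * bp) * j * rinv (1 + bp * j) * (1 - bp * b) = 0 ->
  (b + j) * rinv (1 + bp * j) * bp * (b + j) = b + j.
Proof.
rewrite -defect_eq => t0; have [_ Eu] := rinvP inv_bpj.
have Eb : bp * (b + j) = 1 + bp * j - (1 - bp * b).
  by rewrite mulrDr opprB [RHS]addrC addrA subrK.
by rewrite -mulrA Eb mulrBr t0 subr0 -mulrA Eu mulr1.
Qed.

Lemma regular_add_radicalP : is_regular (b + j) <->
  (1 - b * bp) * j * rinv (1 + bp * j) * (1 - bp * b) = 0.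
Proof.
split=> [[x Ex]|/defect0_inner E]; last first.
  by exists (rinv (1 + bp * j) * bp); rewrite mulrA.
set p := 1 - b * bp; set t := p * j * _ * _.
have pb : p * b = 0 by rewrite mulrBl mul1r hb.1 subrr.
have pp : p * p = p by rewrite {2}/p mulrBr mulr1 mulrA pb mul0r subr0.
have pt : p * t = t by rewrite /t !mulrA pp.
(* By [defect_eq], [t] lies in [(b + j) R], where [(b + j) * x] acts as a left identity. *)
have tE : (b + j) * x * t = t by rewrite /t -defect_eq !mulrA Ex.
clearbody t p.
(* [t = p * (b + j) * x * t = (p * j * x) * t] with [p * j * x] in the radical. *)
have t0 : (1 - p * j * x) * t = 0.
  by rewrite mulrBl mul1r -{1}pt -{1}tE !mulrA mulrDr pb add0r subrr.
have /invertible_jacobson[w [_ Ew]] : jacobson_radical (- (p * j * x)).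
  by apply: jacobson_radicalN; apply: jacobson_radicalMr; apply: jacobson_radicalMl.
by rewrite -[t]mul1r -Ew -(mulrA w) t0 mulr0.
Qed.

Let regular_inner : is_regular (b + j) ->
  b + j = (b + j) * rinv (1 + bp * j) * bp * (b + j).
Proof. by move=> /regular_add_radicalP /defect0_inner ->. Qed.

Lemma regular_add_radical_right : is_regular (b + j) ->
  (exists r, b + j = (1 + j * bp) * b * r) /\
  (exists r, (1 + j * bp) * b = (b + j) * r).
Proof.
move=> /regular_inner E.
have vb : (1 + j * bp) * b = (b + j) * (bp * b).
  by rewrite !mulrDl mul1r !mulrA hb.1.
split; last by exists (bp * b).
(* Obtained from the inner inverse by moving [bp] to the front of the unit and expanding it as
   [bp * b * bp]. *)
exists (bp * rinv (1 + j * bp) * (b + j)); rewrite vb.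
rewrite {1}E -(mulrA (b + j)) rinv_swap // -{1}hb.2.
by rewrite !mulrA.
Qed.

(** The left-ideal counterpart, meant for [c + jc]; again [bp = bp * b * bp] is inserted into the
    inner inverse. *)
Lemma regular_add_radical_left : is_regular (b + j) ->
  (exists s, b + j = s * (b * (1 + bp * j))) /\
  (exists s, b * (1 + bp * j) = s * (b + j)).
Proof.
move=> /regular_inner E.
have bu : b * (1 + bp * j) = b * bp * (b + j).
  by rewrite !mulrDr mulr1 hb.1 mulrA.
split; last by exists (b * bp).
exists ((b + j) * rinv (1 + bp * j) * bp); rewrite bu {1}E -[X in _ * X * _ = _]hb.2.
by rewrite !mulrA.
Qed.

End RegularPerturbation.

(** Keeping [x] general serves two cases: [x = a + ja] with the full [j], and [x = a] with the
    correction [k]. *)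
Lemma bc_inverse_radical_perturb (R : pzRingType) (a b c jb jc bp cp j x y : R) :
  jacobson_radical jb -> jacobson_radical jc -> jacobson_radical j ->
  is_reflexive_inverse b bp -> is_reflexive_inverse c cp ->
  is_regular (b + jb) -> is_regular (c + jc) ->
  is_bc_inverse a b c y -> (1 + cp * jc) * x * (1 + jb * bp) = a + j ->
  is_bc_inverse x (b + jb) (c + jc)
    ((1 + jb * bp) * y * rinv (1 + j * y) * (1 + cp * jc)).
Proof.
move=> Jb Jc Jj hb hc rb rc hy E.
have [b1 b2] := regular_add_radical_right hb Jb rb.
have [c1 c2] := regular_add_radical_left hc Jc rc.
apply: (bc_inverse_assoc b1 b2 c1 c2); rewrite -[_ * y * _]mulrA.
apply: bc_inverse_mul; rewrite E; apply: bc_inverse_perturb => //.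
- by apply: invertible_jacobson; apply: jacobson_radicalMr.
- by apply: invertible_jacobson; apply: jacobson_radicalMl.
Qed.

Theorem theorem3p2 (R : pzRingType) (a b c ja jb jc bp cp : R)
  (hja : jacobson_radical ja) (hjb : jacobson_radical jb)
  (hjc : jacobson_radical jc)
  (hex : bc_invertible a b c)
  (hbp : is_reflexive_inverse b bp) (hcp : is_reflexive_inverse c cp) :
  let y := bc_inv a b c in
  let z := bc_inv a (b + jb) (c + jc) in
  let j := ja + a * jb * bp + cp * jc * a + ja * jb * bp + cp * jc * ja
           + cp * jc * a * jb * bp + cp * jc * ja * jb * bp in
  let k := a * jb * bp + cp * jc * a + cp * jc * a * jb * bp in
  let P1 := bc_invertible (a + ja) (b + jb) (c + jc) in
  let P2 := is_regular (b + jb) /\ is_regular (c + jc) in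
  let P3 := (1 - b * bp) * jb * rinv (1 + bp * jb) * (1 - bp * b) = 0
         /\ (1 - c * cp) * jc * rinv (1 + cp * jc) * (1 - cp * c) = 0 in
  [/\ invertible (1 + bp * jb), invertible (1 + cp * jc),
      P1 <-> P2, P2 <-> P3
    & P1 ->
      [/\ invertible (1 + j * y) /\
          bc_inv (a + ja) (b + jb) (c + jc)
            = (1 + jb * bp) * y * rinv (1 + j * y) * (1 + cp * jc),
          bc_invertible a (b + jb) (c + jc),
          invertible (1 + y * k) /\
          z = (1 + jb * bp) * rinv (1 + y * k) * y * (1 + cp * jc)
        & invertible (1 + z * ja) /\
          bc_inv (a + ja) (b + jb) (c + jc) = rinv (1 + z * ja) * z]].
Proof.
move=> y z j k P1 P2 P3.
have hy : is_bc_inverse a b c y by apply: bc_invP.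
have Jbp : jacobson_radical (bp * jb) by apply: jacobson_radicalMl.
have Jcp : jacobson_radical (cp * jc) by apply: jacobson_radicalMl.
have JM1 := jacobson_radicalMl; have JM2 := jacobson_radicalMr.
have Jk : jacobson_radical k.
  by rewrite /k -!mulrA; do !apply: jacobson_radicalD; auto.
have Jj : jacobson_radical j.
  by rewrite /j -!mulrA; do !apply: jacobson_radicalD; auto.
(* [j] collects the seven terms other than [a] in this expansion; [k] below is its value at
   [ja = 0]. *)
have Ej : (1 + cp * jc) * (a + ja) * (1 + jb * bp) = a + j.
  rewrite /j !(mulrDl, mulrDr) !mul1r !mulr1 !mulrA !addrA.
  by rewrite [LHS](+%R.[ACl 1*2*5*3*6*4*7*8]).
have Ek : (1 + cp * jc) * a * (1 + jb * bp) = a + k.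
  by rewrite /k !(mulrDl, mulrDr) !mul1r !mulr1 !mulrA !addrA (addrAC a).
have inv12 : P2 -> is_bc_inverse (a + ja) (b + jb) (c + jc)
    ((1 + jb * bp) * y * rinv (1 + j * y) * (1 + cp * jc)).
  by move=> [rb rc]; apply: (bc_inverse_radical_perturb _ _ Jj hbp hcp _ _ hy Ej).
have P12 : P1 -> P2 by apply: bc_invertible_regular.
split.
- exact: invertible_jacobson.
- exact: invertible_jacobson.
- by split=> // /inv12 h; eexists; apply: h.
- by split=> -[/(regular_add_radicalP hbp hjb) ? /(regular_add_radicalP hcp hjc) ?].
move=> /P12 reg; have [rb rc] := reg.
have inv_ky : invertible (1 + k * y) by apply: invertible_jacobson; apply: JM2.
have inv_yk : invertible (1 + y * k) by apply: invertible_jacobson; apply: JM1.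
have inv_jaz : invertible (1 + ja * z) by apply: invertible_jacobson; apply: JM2.
have inv_zja : invertible (1 + z * ja) by apply: invertible_jacobson; apply: JM1.
have hz := bc_inverse_radical_perturb hjb hjc Jk hbp hcp rb rc hy Ek.
have zex : bc_invertible a (b + jb) (c + jc) by eexists; apply: hz.
split=> //; split=> //.
- by apply: invertible_jacobson; apply: JM2.
- exact/bc_inv_eq/inv12.
- by rewrite /z (bc_inv_eq hz) -!mulrA [rinv _ * (y * _)]mulrA rinv_swap // !mulrA.
(* Here the perturbation by [ja] starts from [z], with [b + jb] and [c + jc] kept fixed. *)
- rewrite rinv_swap //; apply: bc_inv_eq; apply: bc_inverse_perturb => //.
  exact: bc_invP.
Qed.
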